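(* $$\sum_{k=1}^\infty\frac{S_1(2k)+2S_1(k)}{k^2\binom{2k}{k}}=\frac53\zeta_3.$$
   Context: $S_1(n):=\sum_{i=1}^n \frac1i$ is the $n$-th harmonic number, and $\zeta_3:=\sum_{i=1}^\infty \frac{1}{i^3}$. *)

(* Defs.v *)
From Stdlib Require Import Reals.
From Coquelicot Require Import Coquelicot.
Open Scope R_scope.

Definition S1 (n : nat) : R := sum_n_m (fun i => 1 / INR i) 1 n.

(* Coquelicot series are indexed from 0, hence the shift by one. *)
Definition zeta3 : R := Series (fun j => 1 / INR (S j) ^ 3).

(* Main.v *)
Require Import Defs.
From Stdlib Require Import Reals.
From Coquelicot Require Import Coquelicot.
From Stdlib Require Import Factorial Lra Lia.
Open Scope R_scope.

(** The proof is a path-invariance argument of Gosper's kind.  The edges of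
    the quarter-plane grid carry weights: [H m j] on the horizontal edge from
    [(m, j)] to [(m + 1, j)] and [V m j] on the vertical edge from [(m, j)] to
    [(m, j + 1)], such that the two ways around any unit square have the same
    total weight ([path_invariance]).  Hence every monotone path from the
    origin to [(n, n)] has the same weight.

    The staircase that goes right, then up, has steps of weight exactly
    [(S1 (2k) + 2 S1 k) / (k^2 C(2k, k))] with [k = m + 1]
    ([staircase_step]).  The path along the bottom row collects
    [5/3 * 1/k^3] ([H_bottom]) and then climbs the column [m = n], whose weight
    tends to [0] ([column_bound]).

    Without the harmonic factors, the weights [w m j / (m + 1)] and
    [w m j / (j + 1)], where [w m j] is the Beta value [B(m+1, j+1)], are
    path-invariant too and prove [zeta(2) = 3 sum 1 / (k^2 C(2k, k))].  The
    harmonic factors come from differentiating deformations of that pair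
    with respect to parameters: shifts of [m] and of [j], and a deformation
    through Gauss's summation of [2F1] at [1], whose derivative has factors
    [S1 m] and [S1 m + 1/(j+1)].  In the combination with coefficients [-4/3],
    [1] and [1] the double sums [S1 k / k^2] cancel on the bottom row, so
    that only cubes remain there. *)

(** * Harmonic numbers and the Beta weights *)

Lemma S1_S (n : nat) : S1 (S n) = S1 n + / INR (S n).
Proof.
unfold S1; rewrite sum_n_Sm; [|lia].
change plus with Rplus; unfold Rdiv; now rewrite Rmult_1_l.
Qed.

Lemma S1_0 : S1 0 = 0.
Proof. unfold S1; rewrite sum_n_m_zero; [reflexivity|lia]. Qed.

Lemma inv_INR_S_le_1 (n : nat) : / INR (S n) <= 1.
Proof.
rewrite <- Rinv_1; apply Rinv_le_contravar; [lra|].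
rewrite S_INR; pose proof (pos_INR n); lra.
Qed.

Lemma S1_incr (p n : nat) : S1 p <= S1 (p + n) <= S1 p + INR n.
Proof.
induction n as [|n IH].
- rewrite Nat.add_0_r; simpl INR; lra.
- rewrite Nat.add_succ_r, S1_S, (S_INR n).
  pose proof (inv_INR_S_le_1 (p + n)).
  pose proof (Rinv_0_lt_compat _ (lt_0_INR (S (p + n)) ltac:(lia))).
  lra.
Qed.

Definition w (m j : nat) : R :=
  INR (fact m) * INR (fact j) / INR (fact (S (m + j))).

Lemma w_pos (m j : nat) : 0 < w m j.
Proof.
unfold w; apply Rdiv_lt_0_compat; [apply Rmult_lt_0_compat|]; apply INR_fact_lt_0.
Qed.

Lemma w_Sl (m j : nat) :
  w (S m) j = w m j * ((INR m + 1) / (INR m + INR j + 2)).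
Proof.
pose proof (pos_INR m); pose proof (pos_INR j).
unfold w; replace (S (S m + j)) with (S (S (m + j))) by lia.
rewrite (fact_simpl m), (fact_simpl (S (m + j))), !mult_INR, !S_INR, plus_INR.
field; split; [lra|apply INR_fact_neq_0].
Qed.

Lemma w_Sr (m j : nat) :
  w m (S j) = w m j * ((INR j + 1) / (INR m + INR j + 2)).
Proof.
pose proof (pos_INR m); pose proof (pos_INR j).
unfold w; replace (S (m + S j)) with (S (S (m + j))) by lia.
rewrite (fact_simpl j), (fact_simpl (S (m + j))), !mult_INR, !S_INR, plus_INR.
field; split; [lra|apply INR_fact_neq_0].
Qed.

Lemma w_0r (m : nat) : w m 0 = / (INR m + 1).
Proof.
unfold w; rewrite Nat.add_0_r, fact_simpl, mult_INR, S_INR.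
simpl (INR (fact 0)); field.
split; [pose proof (pos_INR m); lra|apply INR_fact_neq_0].
Qed.

(** For fixed [m] the weight decreases in [j], so it is at most [w m 1] as
    soon as [j >= 1]; this gains a factor [m + 2] over the bottom row, which
    is what makes a whole column small. *)
Lemma w_Sr_le (m j : nat) : w m (S j) <= / (INR m + 1) * / (INR m + 2).
Proof.
pose proof (pos_INR m).
induction j as [|j IH].
- rewrite w_Sr, w_0r; simpl INR; right; field; lra.
- apply Rle_trans with (2 := IH).
  rewrite (w_Sr m (S j)).
  apply Rle_trans with (w m (S j) * 1); [|lra].
  apply Rmult_le_compat_l; [left; apply w_pos|].
  pose proof (pos_INR (S j)).
  apply -> Rdiv_le_1; lra.
Qed.

(** * Path-invariant edge weights *)

Definition H (m j : nat) : R :=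
  w m j / INR (S m) *
  (S1 j + (S1 (S m + j) - S1 (S m)) / 3 + 5 / (3 * INR (S m))).

Definition V (m j : nat) : R :=
  w m j / INR (S j) * (S1 j + (S1 (S m + j) - S1 m) / 3).

(** Dividing by [w m j] and expressing every harmonic number through [S1 m],
    [S1 j] and [S1 (m + j + 1)] turns this into an identity of rational
    functions. *)
Lemma path_invariance (m j : nat) : H m j + V (S m) j = V m j + H m (S j).
Proof.
pose proof (pos_INR m); pose proof (pos_INR j).
unfold H, V; rewrite w_Sl, w_Sr.
replace (S (S m) + j)%nat with (S (S m + j)) by lia.
replace (S m + S j)%nat with (S (S m + j)) by lia.
rewrite (S1_S (S m + j)), (S1_S m), (S1_S j), !S_INR, plus_INR, !S_INR.
field; repeat split; lra.
Qed.

Lemma H_bottom (m : nat) : H m 0 = 5 / 3 * (1 / INR (S m) ^ 3).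
Proof.
unfold H; rewrite w_0r, S1_0, Nat.add_0_r, S_INR.
field; pose proof (pos_INR m); lra.
Qed.

Lemma staircase_step (m : nat) :
  H m m + V (S m) m =
  (S1 (2 * S m) + 2 * S1 (S m)) / (INR (S m) ^ 2 * Binomial.C (2 * S m) (S m)).
Proof.
pose proof (pos_INR m).
unfold H, V, Binomial.C; rewrite w_Sl; unfold w.
replace (2 * S m - S m)%nat with (S m) by lia.
replace (2 * S m)%nat with (S (S (m + m))) by lia.
replace (S (S m) + m)%nat with (S (S (m + m))) by lia.
replace (S m + m)%nat with (S (m + m)) by lia.
rewrite (S1_S (S (m + m))), (S1_S m), (fact_simpl m), (fact_simpl (S (m + m))),
  !mult_INR, !S_INR, plus_INR.
field; repeat split; try apply INR_fact_neq_0; lra.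
Qed.

(** * Comparison of the two paths *)

Lemma paths_agree (n : nat) :
  sum_n (fun m => H m m + V (S m) m) n =
  sum_n (fun m => H m 0) n + sum_n (V (S n)) n.
Proof.
(* Right and then up the column [m + 1] weighs the same as up the column [m]
   and then right. *)
assert (shift : forall m j,
  H m 0 + sum_n (V (S m)) j = sum_n (V m) j + H m (S j)).
{ intros m j; induction j as [|j IH].
  - rewrite !sum_O; apply path_invariance.
  - rewrite !sum_Sn; change plus with Rplus.
    pose proof (path_invariance m (S j)); lra. }
induction n as [|n IH].
- rewrite !sum_O; reflexivity.
- rewrite (sum_Sn (fun m => H m m + _)), (sum_Sn (fun m => H m 0)), IH.
  rewrite (sum_Sn (V (S (S n)))); change plus with Rplus.
  pose proof (shift (S n) n); lra.
Qed.

(** Trivial bounds [S1 j <= j] and [S1 (m + j + 1) - S1 m <= j + 1] make the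
    harmonic factor at most [4/3 (j + 1)], which the denominator absorbs. *)
Lemma V_bound (m j : nat) : 0 <= V m j <= 2 * w m j.
Proof.
pose proof (w_pos m j); pose proof (pos_INR j).
pose proof (S1_incr 0 j) as Hj; rewrite S1_0 in Hj; simpl in Hj.
pose proof (S1_incr m (S j)) as Hm.
unfold V; replace (S m + j)%nat with (m + S j)%nat by lia.
rewrite S_INR in *.
assert (0 < / (INR j + 1)) by (apply Rinv_0_lt_compat; lra).
split.
- apply Rmult_le_pos; [apply Rmult_le_pos|]; lra.
- apply Rle_trans with (w m j / (INR j + 1) * (2 * (INR j + 1))).
  + apply Rmult_le_compat_l; [apply Rmult_le_pos|]; lra.
  + right; field; lra.
Qed.

Lemma column_bound (n : nat) : 0 <= sum_n (V (S n)) n <= 4 / INR (S n).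
Proof.
pose proof (pos_INR n) as Hn.
(* The bottom edge counts at most [2/(n+2)], every other edge at most
   [2/((n+2)(n+3))]. *)
assert (Hk : forall k, 0 <= sum_n (V (S n)) k
  <= 2 * / (INR n + 2) + INR k * (2 * (/ (INR n + 2) * / (INR n + 3)))).
{ induction k as [|k IH].
  - rewrite sum_O; simpl INR.
    pose proof (V_bound (S n) 0) as HV; rewrite w_0r, S_INR in HV.
    replace (INR n + 1 + 1) with (INR n + 2) in HV by ring; lra.
  - rewrite sum_Sn; change plus with Rplus; rewrite (S_INR k).
    pose proof (V_bound (S n) (S k)) as HV.
    pose proof (w_Sr_le (S n) k) as Hw; rewrite S_INR in Hw.
    replace (INR n + 1 + 1) with (INR n + 2) in Hw by ring.
    replace (INR n + 1 + 2) with (INR n + 3) in Hw by ring; lra. }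
split; [apply Hk|].
apply Rle_trans with (1 := proj2 (Hk n)).
apply Rle_trans with (4 * / (INR n + 2)).
- assert (0 < / (INR n + 2)) by (apply Rinv_0_lt_compat; lra).
  assert (INR n * / (INR n + 3) <= 1) by (apply -> Rdiv_le_1; lra).
  replace (INR n * (2 * (/ (INR n + 2) * / (INR n + 3))))
    with (2 * / (INR n + 2) * (INR n * / (INR n + 3))) by ring.
  nra.
- rewrite S_INR; apply Rmult_le_compat_l; [lra|].
  apply Rinv_le_contravar; lra.
Qed.

Lemma column_lim : is_lim_seq (fun n => sum_n (V (S n)) n) 0.
Proof.
apply is_lim_seq_le_le with (fun _ => 0) (fun n => 4 * / INR (S n)).
- apply column_bound.
- apply is_lim_seq_const.
- replace (Finite 0) with (Rbar_mult 4 0) by (simpl; f_equal; ring).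
  apply is_lim_seq_scal_l.
  apply (is_lim_seq_incr_1 (fun n => / INR n)).
  replace (Finite 0) with (Rbar_inv p_infty) by reflexivity.
  apply is_lim_seq_inv; [apply is_lim_seq_INR|discriminate].
Qed.

Lemma zeta3_series : is_series (fun j => 1 / INR (S j) ^ 3) zeta3.
Proof.
apply Series_correct.
assert (pos : forall n, 0 < 1 / INR (S n) ^ 3).
{ intros n; apply Rdiv_lt_0_compat; [lra|].
  apply pow_lt, lt_0_INR; lia. }
apply (ex_finite_lim_seq_incr _ 2).
- intros n; rewrite sum_Sn; change plus with Rplus; pose proof (pos (S n)); lra.
- intros n; apply Rle_trans with (2 - / INR (S n)).
  + induction n as [|n IH].
    * rewrite sum_O; simpl INR; lra.
    * rewrite sum_Sn; change plus with Rplus.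
      (* [1/(n+2)^3 <= 1/((n+1)(n+2))], which telescopes. *)
      assert (1 / INR (S (S n)) ^ 3 <= / INR (S n) - / INR (S (S n))); [|lra].
      pose proof (pos_INR n).
      rewrite (S_INR (S n)), (S_INR n).
      replace (/ (INR n + 1) - / (INR n + 1 + 1))
        with (1 / ((INR n + 1) * (INR n + 2))) by (field; lra).
      apply Rmult_le_compat_l; [lra|].
      apply Rinv_le_contravar; nra.
  + pose proof (Rinv_0_lt_compat _ (lt_0_INR (S n) ltac:(lia))); lra.
Qed.

(* Coquelicot exports its own C (the complex numbers); Binomial.C is the
   real-valued binomial coefficient. The summation index is k = S j >= 1. *)
Theorem mainTheorem7 :
  is_series
    (fun j : nat =>
       let k := S j in
       (S1 (2 * k) + 2 * S1 k) / (INR k ^ 2 * Binomial.C (2 * k) k))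
    (5 / 3 * zeta3).
Proof.
apply is_series_ext with (fun m => H m m + V (S m) m).
{ intros m; apply staircase_step. }
assert (bottom : is_series (fun m => H m 0) (5 / 3 * zeta3)).
{ apply is_series_ext with (fun m => scal (5 / 3) (1 / INR (S m) ^ 3)).
  - intros m; symmetry; apply H_bottom.
  - exact (is_series_scal (5 / 3) _ _ zeta3_series). }
apply (is_lim_seq_ext (fun n => sum_n (fun m => H m 0) n + sum_n (V (S n)) n)
  _ (5 / 3 * zeta3)).
{ intros n; symmetry; apply paths_agree. }
rewrite <- (Rplus_0_r (5 / 3 * zeta3)).
apply is_lim_seq_plus'; [exact bottom|exact column_lim].
Qed.
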